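(* Let $K\subset\mathbb{R}^m$ be a self-dual cone and let $\sqcap,\sqcup$ be the generalized lattice operations defined by $K$. Let $C\subset\mathbb{R}^m$ be a polyhedron with nonempty interior, represented as $$C=\bigcap_{i=1}^q H_-(u_i,a_i),$$ with $u_i\in\mathbb{R}^m\setminus\{0\}$, $a_i\in\mathbb{R}^m$, where the representation is sharp in the sense that each set $H(u_i,a_i)\cap C$ is a hyperface of $C$ ($i=1,\dots,q$). Then the following assertions are equivalent: (i) $C$ is invariant with respect to $\sqcap$ and $\sqcup$; (ii) the projection $P_C$ is isotone with respect to the order $\le_K$; (iii) each hyperplane $H(u_i,a_i)$, $i=1,\dots,q$, is invariant with respect to $\sqcap$ and $\sqcup$; (iv) each hyperplane $H(u_i,a_i)$, $i=1,\dots,q$, is an isotone projection set; (v) each proper face of $C$ is invariant with respect to $\sqcap$ and $\sqcup$.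
   Context: $\mathbb{R}^m$ carries the standard scalar product $\langle\cdot,\cdot\rangle$. A convex cone is a nonempty set $K$ with $K+K\subset K$ and $tK\subset K$ for all $t\ge 0$; it is self-dual if $K=K^*:=\{y\in\mathbb{R}^m:\langle x,y\rangle\ge 0\ \forall x\in K\}$. The order induced by $K$ is $x\le_K y\Leftrightarrow y-x\in K$. For a nonempty closed convex set $D$, $P_D x$ denotes the unique nearest point of $D$ to $x$; $P_D$ is isotone, and $D$ is called an isotone projection set, if $x\le_K y$ implies $P_Dx\le_K P_Dy$. Generalized lattice operations: $x\sqcap y=P_{x-K}\,y$ and $x\sqcup y=P_{x+K}\,y$. A set $M\subset\mathbb{R}^m$ is invariant with respect to $\sqcap$ and $\sqcup$ if $x,y\in M$ implies $x\sqcap y\in M$ and $x\sqcup y\in M$. For $u\neq 0$ and $a\in\mathbb{R}^m$: $H(u,a)=\{x:\langle u,x\rangle=\langle u,a\rangle\}$ and $H_-(u,a)=\{x:\langle u,x\rangle\le\langle u,a\rangle\}$. A face of a nonempty closed convex set $M$ is a nonempty convex subset $M_0\subset M$ such that $x,y\in M$ and $tx+(1-t)y\in M_0$ for some $t\in(0,1)$ imply $x,y\in M_0$; it is proper if $M_0\ne M$. If $M\subset\mathbb{R}^m$ has nonempty interior, a hyperface of $M$ is a face of $M$ of (affine) dimension $m-1$. *)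

(* Defs.v *)
From HB Require Import structures.
From mathcomp Require Import all_boot all_order all_algebra.
From mathcomp Require Import all_classical all_reals all_analysis.

Set Implicit Arguments.
Unset Strict Implicit.
Unset Printing Implicit Defensive.

Import Order.TTheory GRing.Theory Num.Theory.
Import numFieldNormedType.Exports.

Local Open Scope classical_set_scope.
Local Open Scope ring_scope.

(* The norm carried by 'rV[R]_m in the library is the sup norm; it induces the
   usual topology but not the Euclidean nearest points, hence [enorm]. *)

Definition dot (R : realType) (m : nat) (x y : 'rV[R]_m) : R :=
  \sum_(i < m) x 0 i * y 0 i.

Definition enorm (R : realType) (m : nat) (x : 'rV[R]_m) : R :=
  Num.sqrt (dot x x).

Definition convex_cone (R : realType) (m : nat) (K : set 'rV[R]_m) : Prop :=
  [/\ K !=set0,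
      forall x y, K x -> K y -> K (x + y) &
      forall (t : R) x, 0 <= t -> K x -> K (t *: x)].

Definition dual_cone (R : realType) (m : nat) (K : set 'rV[R]_m) :
  set 'rV[R]_m := [set y | forall x, K x -> 0 <= dot x y].

Definition self_dual_cone (R : realType) (m : nat) (K : set 'rV[R]_m) : Prop :=
  convex_cone K /\ K = dual_cone K.

Definition cone_le (R : realType) (m : nat) (K : set 'rV[R]_m)
  (x y : 'rV[R]_m) : Prop := K (y - x).

Definition nearest (R : realType) (m : nat) (D : set 'rV[R]_m)
  (x p : 'rV[R]_m) : Prop :=
  D p /\ forall z, D z -> enorm (x - p) <= enorm (x - z).

(* Meaningful when D is nonempty, closed and convex: the nearest point then
   exists and is unique. The value 0 is a default for the other sets. *)
Definition metric_proj (R : realType) (m : nat) (D : set 'rV[R]_m) (x : 'rV[R]_m) :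
  'rV[R]_m := xget 0 [set p | nearest D x p].

Definition isotone (R : realType) (m : nat) (K : set 'rV[R]_m)
  (f : 'rV[R]_m -> 'rV[R]_m) : Prop :=
  forall x y, cone_le K x y -> cone_le K (f x) (f y).

Definition isotone_projection_set (R : realType) (m : nat)
  (K D : set 'rV[R]_m) : Prop :=
  [/\ D !=set0, closed D, @convex_set R 'rV[R]_m D & isotone K (metric_proj D)].

Definition gmeet (R : realType) (m : nat) (K : set 'rV[R]_m)
  (x y : 'rV[R]_m) : 'rV[R]_m := metric_proj [set x - k | k in K] y.

Definition gjoin (R : realType) (m : nat) (K : set 'rV[R]_m)
  (x y : 'rV[R]_m) : 'rV[R]_m := metric_proj [set x + k | k in K] y.

Definition gl_invariant (R : realType) (m : nat) (K M : set 'rV[R]_m) : Prop :=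
  forall x y, M x -> M y -> M (gmeet K x y) /\ M (gjoin K x y).

Definition hyperplane (R : realType) (m : nat) (u a : 'rV[R]_m) :
  set 'rV[R]_m := [set x | dot u x = dot u a].

Definition halfspace (R : realType) (m : nat) (u a : 'rV[R]_m) :
  set 'rV[R]_m := [set x | dot u x <= dot u a].

Definition face (R : realType) (m : nat) (M F : set 'rV[R]_m) : Prop :=
  [/\ F !=set0, F `<=` M, @convex_set R 'rV[R]_m F &
      forall (x y : 'rV[R]_m) (t : R), M x -> M y -> 0 < t < 1 ->
        F (t *: x + (1 - t) *: y) -> F x /\ F y].

Definition proper_face (R : realType) (m : nat) (M F : set 'rV[R]_m) : Prop :=
  face M F /\ F <> M.

Definition affine_hull (R : realType) (m : nat) (S : set 'rV[R]_m) :
  set 'rV[R]_m :=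
  [set x | exists (n : nat) (c : 'I_n -> R) (s : 'I_n -> 'rV[R]_m),
    [/\ forall i, S (s i), \sum_(i < n) c i = 1 &
        x = \sum_(i < n) c i *: s i]].

Definition has_affine_dim (R : realType) (m : nat) (S : set 'rV[R]_m)
  (d : nat) : Prop :=
  exists (a : 'rV[R]_m) (V : {vspace 'rV[R]_m}),
    affine_hull S = [set a + v | v in [set` V]] /\ \dim V = d.

(* [d.+1 = m] rather than [d = m.-1], which would be a truncated difference. *)
Definition hyperface (R : realType) (m : nat) (M F : set 'rV[R]_m) : Prop :=
  face M F /\ exists2 d : nat, d.+1 = m & has_affine_dim F d.

(* Main.v *)
(* Self-duality gives the Moreau decomposition z = p - n with p, n in K and
   <p,n> = 0; writing x - y = p - n, one has x /\ y = x - p and x \/ y = x + n,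
   so that meet and join have the same midpoint as x and y.  The pivot
   is the condition that K is stable under the orthogonal projection along
   u = u_i:
   - it is the isotonicity of the projection onto H(u,a);
   - it forces <u,p> <u,n> <= 0 whenever p, n in K are orthogonal, so that
     half-spaces and hyperplanes with normal u, hence C, are invariant;
   - conversely it follows from the invariance of H(u,a), or from that of the
     hyperface, or from the isotonicity of P_C, by looking near a relative
     interior point of the hyperface, where C is a half-space.
   Invariance of C implies isotonicity of P_C by testing the variational
   inequalities at the meet and the join of the two projections, and passes to
   the faces of C because meet and join have the midpoint of x and y. *)

Require Import Defs.
From mathcomp Require Import all_boot all_order all_algebra.
From mathcomp Require Import all_classical all_reals all_analysis.
From mathcomp Require Import ring lra.

Import Order.TTheory GRing.Theory Num.Theory.
Import numFieldNormedType.Exports.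

Local Open Scope classical_set_scope.
Local Open Scope ring_scope.

(** * Euclidean scalar product, continuity, closed and convex half-spaces *)

Section Dot.
Context {R : realType} {m : nat}.
Implicit Types x y z u : 'rV[R]_m.

Lemma dotC x y : dot x y = dot y x.
Proof. by apply: eq_bigr => i _; rewrite mulrC. Qed.

Lemma dotDr x y z : dot x (y + z) = dot x y + dot x z.
Proof. by rewrite -big_split; apply: eq_bigr => i _; rewrite mxE mulrDr. Qed.

Lemma dotZr (t : R) x y : dot x (t *: y) = t * dot x y.
Proof. by rewrite mulr_sumr; apply: eq_bigr => i _; rewrite mxE mulrCA. Qed.

Lemma dotNr x y : dot x (- y) = - dot x y.
Proof. by rewrite -scaleN1r dotZr mulN1r. Qed.

Lemma dotDl x y z : dot (x + y) z = dot x z + dot y z.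
Proof. by rewrite dotC dotDr !(dotC z). Qed.

Lemma dotZl (t : R) x y : dot (t *: x) y = t * dot x y.
Proof. by rewrite dotC dotZr dotC. Qed.

Lemma dotNl x y : dot (- x) y = - dot x y.
Proof. by rewrite dotC dotNr dotC. Qed.

Lemma dot0r x : dot x 0 = 0.
Proof. by rewrite -(scale0r 0) dotZr mul0r. Qed.

Definition dotE := (dotDr, dotDl, dotNr, dotNl, dotZr, dotZl).

Lemma dot_ge0 x : 0 <= dot x x.
Proof. by apply: sumr_ge0 => i _; rewrite -expr2 sqr_ge0. Qed.

Lemma dot_eq0 x : (dot x x == 0) = (x == 0).
Proof.
apply/eqP/eqP => [|->]; last exact: dot0r.
move/eqP; rewrite psumr_eq0 => [/allP x0|i _]; last by rewrite -expr2 sqr_ge0.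
apply/rowP => i; rewrite mxE; apply/eqP.
by have := x0 i (mem_index_enum i); rewrite mulf_eq0 orbb.
Qed.

Lemma dot_gt0 x : (0 < dot x x) = (x != 0).
Proof. by rewrite lt_def dot_ge0 andbT dot_eq0. Qed.

Lemma sum_continuous (I : Type) (r : seq I) (F : I -> 'rV[R]_m -> R) :
  (forall i, continuous (F i)) -> continuous (fun x => \sum_(i <- r) F i x).
Proof.
move=> cF; apply: (@continuous_big R I +%R 0 xpredT) => // t.
by apply: cvgD; [exact: cvg_fst|exact: cvg_snd].
Qed.

Lemma dot_continuous x : continuous (dot x).
Proof.
apply: sum_continuous => i y.
apply: (@continuousM R _ (fun=> x 0 i) (fun z : 'rV[R]_m => z 0 i)).
  exact: cst_continuous.
exact: coord_continuous.
Qed.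

Lemma sqdist_continuous x :
  continuous (fun z : 'rV[R]_m => dot (x - z) (x - z)).
Proof.
apply: sum_continuous => i y.
have h : {for y, continuous (fun z : 'rV[R]_m => (x - z) 0 i)}.
  have -> : (fun z => (x - z) 0 i) = (fun z => x 0 i - z 0 i).
    by apply: funext => z; rewrite !mxE.
  apply: (@continuousB R R^o _ (fun=> x 0 i) (fun z : 'rV[R]_m => z 0 i)).
    exact: cst_continuous.
  exact: coord_continuous.
exact: continuousM.
Qed.

Lemma halfspace_closed u a : closed (halfspace u a).
Proof.
have -> : halfspace u a = dot u @^-1` [set t | t <= dot u a] by [].
move/continuous_closedP: (dot_continuous u); apply; exact: closed_le.
Qed.

Lemma hyperplane_closed u a : closed (hyperplane u a).
Proof.
have -> : hyperplane u a = dot u @^-1` [set t | t = dot u a] by [].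
move/continuous_closedP: (dot_continuous u); apply; exact: closed_eq.
Qed.

Lemma convex_setP (D : set 'rV[R]_m) :
  @convex_set R 'rV[R]_m D <->
  forall x y (t : R), D x -> D y -> 0 <= t <= 1 -> D (t *: x + (1 - t) *: y).
Proof.
split => [cD x y t Dx Dy /andP[t0 t1]|cD x y t xD yD].
  exact: (set_mem (cD x y (Itv01 t0 t1) (mem_set Dx) (mem_set Dy))).
apply/mem_set/cD; [exact/set_mem|exact/set_mem|].
by apply/andP; split; [exact: ge0|exact: le1].
Qed.

Lemma hyperplane_convex u a : @convex_set R 'rV[R]_m (hyperplane u a).
Proof.
apply/convex_setP => x y t; rewrite /hyperplane /= !dotE => -> -> _.
by rewrite -mulrDl addrC subrK mul1r.
Qed.

Lemma halfspace_convex u a : @convex_set R 'rV[R]_m (halfspace u a).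
Proof.
apply/convex_setP => x y t; rewrite /halfspace /= !dotE => ux uy /andP[t0 t1].
nra.
Qed.

Lemma bigcap_convex (I : Type) (A : I -> set 'rV[R]_m) :
  (forall i, @convex_set R 'rV[R]_m (A i)) ->
  @convex_set R 'rV[R]_m (\bigcap_i A i).
Proof.
move=> cA; apply/convex_setP => x y t Ax Ay t01 i _.
by apply: (convex_setP (A i)).1 t01 => //; [exact: Ax|exact: Ay].
Qed.

End Dot.

(** * Nearest points: existence, variational inequality, uniqueness *)

Section Projection.
Context {R : realType} {m : nat}.
Implicit Types (D : set 'rV[R]_m) (x y z p : 'rV[R]_m).

Lemma nearest_sq D x p :
  nearest D x p <->
  D p /\ forall z, D z -> dot (x - p) (x - p) <= dot (x - z) (x - z).
Proof.
by split=> -[Dp h]; split=> // z /h; rewrite /enorm ler_sqrt ?dot_ge0.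
Qed.

(** The squared distance attains its minimum on the compact part of [D] in a box holding every point
    no farther from [x] than [z0]. *)
Lemma nearest_exists D x : closed D -> D !=set0 -> exists p, nearest D x p.
Proof.
move=> clD [z0 Dz0].
pose f z := dot (x - z) (x - z).
(* Large enough without a square root: |s| <= s^2 + 1/4 for each coordinate s of [x - z]. *)
pose M := f z0 + 1.
pose B : set 'rV[R]_m :=
  [set v | forall i, `[x 0 i - M, x 0 i + M]%classic (v ord0 i)].
have cB : compact B.
  apply: (@rV_compact R m (fun i => `[x 0 i - M, x 0 i + M]%classic)) => i.
  exact: segment_compact.
have cBD : compact (B `&` D) by exact: compact_closedI.
have Bf z : f z <= f z0 -> B z.
  move=> fz i; rewrite /= in_itv /=.
  have : (x 0 i - z 0 i) ^+ 2 <= f z0.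
    apply: le_trans fz; rewrite /f /dot (bigD1 i) //= !mxE -expr2 lerDl.
    by apply: sumr_ge0 => j _; rewrite -expr2 sqr_ge0.
  rewrite /M; have := sqr_ge0 (x 0 i - z 0 i - 1 / 2).
  by have := sqr_ge0 (x 0 i - z 0 i + 1 / 2) => *; apply/andP; split; lra.
have BD0 : B `&` D !=set0 by exists z0; split => //; exact: Bf.
have cf : {within B `&` D, continuous f}.
  by apply: continuous_subspaceT; exact: sqdist_continuous.
have [p pBD pmin] := compact_EVT_min BD0 cBD cf.
have [_ Dp] := set_mem pBD.
exists p; apply/nearest_sq; split=> // z Dz.
have [/Bf Bz|fz] := leP (f z) (f z0); first by apply: pmin; apply/mem_set.
apply: le_trans (ltW fz); apply: pmin; apply/mem_set; split=> //.
exact: Bf.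
Qed.

Lemma metric_proj_nearest D x :
  closed D -> D !=set0 -> nearest D x (metric_proj D x).
Proof.
move=> clD D0; have [p xp] := nearest_exists D x clD D0.
exact: (@xgetI _ 0 [set p | nearest D x p] p xp).
Qed.

Lemma nearest_variational D x p :
  @convex_set R 'rV[R]_m D -> nearest D x p ->
  forall z, D z -> dot (x - p) (z - p) <= 0.
Proof.
move=> /convex_setP cD /nearest_sq [Dp pmin] z Dz.
rewrite leNgt; apply/negP => h.
set b := dot (x - p) (z - p) in h; set c := dot (z - p) (z - p).
have c0 : 0 <= c by exact: dot_ge0.
(* Moving from [p] towards [z] by [t] changes the squared distance by t (t c - 2 b). This [t] is at
   most 1 and gives t c <= b, even if c = 0. *)
pose t := b / (b + c).
have bc0 : 0 < b + c by lra.
have t0 : 0 < t by exact: divr_gt0.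
have t1 : t <= 1 by rewrite ler_pdivrMr //; lra.
have tE : t * (b + c) = b by rewrite divfK // gt_eqF.
have t01 : 0 <= t <= 1 by rewrite ltW.
have := pmin _ (cD _ _ _ Dz Dp t01).
have -> : x - (t *: z + (1 - t) *: p) = (x - p) - t *: (z - p).
  by apply/rowP => i; rewrite !mxE; ring.
have -> : dot (x - p - t *: (z - p)) (x - p - t *: (z - p)) =
  dot (x - p) (x - p) - 2 * t * b + t * t * c.
  rewrite /b /c; move: (x - p) (z - p) => v w.
  by rewrite !dotE (dotC w v); ring.
by nra.
Qed.

(** Expanding the squared distance around [p] shows that [p] is nearest, and then that the point
    chosen by [xget] is at distance 0 from [p]. *)
Lemma metric_proj_eq D x p :
  D p -> (forall z, D z -> dot (x - p) (z - p) <= 0) -> metric_proj D x = p.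
Proof.
move=> Dp vp.
have expand z : dot (x - z) (x - z) =
    dot (x - p) (x - p) + dot (z - p) (z - p) - 2 * dot (x - p) (z - p).
  have -> : x - z = (x - p) - (z - p) by rewrite opprB addrA subrK.
  by move: (x - p) (z - p) => v w; rewrite !dotE (dotC w v); ring.
have np : nearest D x p.
  apply/nearest_sq; split=> // z Dz; rewrite (expand z).
  by have := vp z Dz; have := dot_ge0 (z - p); lra.
have /nearest_sq [Dr rmin] : nearest D x (metric_proj D x).
  exact: (@xgetI _ 0 [set p | nearest D x p] p np).
apply/eqP; rewrite -subr_eq0 -dot_eq0 eq_le dot_ge0 andbT.
have := rmin p Dp; rewrite (expand (metric_proj D x)).
by have := vp _ Dr; lra.
Qed.

Lemma metric_proj_id D x : D x -> metric_proj D x = x.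
Proof.
by move=> Dx; apply: metric_proj_eq => // z _; rewrite subrr dotC dot0r.
Qed.

Lemma metric_proj_hyperplane u a x : u != 0 ->
  metric_proj (hyperplane u a) x =
  x - (dot u (x - a) / dot u u) *: u.
Proof.
rewrite -dot_gt0 => u0.
set s := _ / _; set p := x - _.
have pH : dot u p = dot u a by rewrite /p dotDr dotNr dotZr divfK ?gt_eqF // !dotE; ring.
have xp : x - p = s *: u by rewrite opprB addrC subrK.
apply: metric_proj_eq => // z; rewrite /hyperplane /= => zH.
by rewrite xp dotZl dotDr dotNr pH zH subrr mulr0.
Qed.

End Projection.

(** * Moreau decomposition, meet and join, stability of the cone along a normal *)

Section SelfDualCone.
Context {R : realType} {m : nat} (K : set 'rV[R]_m).
Hypothesis hK : self_dual_cone K.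
Implicit Types (x y z w p n u a c : 'rV[R]_m) (C F : set 'rV[R]_m).

Lemma coneD x y : K x -> K y -> K (x + y).
Proof. by case: hK => -[_ + _] _; apply. Qed.

Lemma coneZ (t : R) x : 0 <= t -> K x -> K (t *: x).
Proof. by case: hK => -[_ _ +] _; apply. Qed.

Lemma coneZ_pos (t : R) x : 0 < t -> K (t *: x) -> K x.
Proof.
move=> t0 /(coneZ (t^-1)); rewrite scalerA mulVf ?gt_eqF // scale1r.
by apply; rewrite invr_ge0 ltW.
Qed.

Lemma cone0 : K 0.
Proof. by case: hK => -[[x Kx] _ _] _; rewrite -(scale0r x); exact: coneZ. Qed.

Lemma dot_cone_ge0 x y : K x -> K y -> 0 <= dot x y.
Proof. by move=> Kx; case: hK => _ ->; apply. Qed.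

Lemma mem_self_dual x : (forall y, K y -> 0 <= dot y x) -> K x.
Proof. by case: hK => _ {2}->. Qed.

Lemma cone_closed : closed K.
Proof.
have -> : K = \bigcap_(x in K) halfspace (- x) 0.
  rewrite eqEsubset; split=> y.
    by move=> Ky x Kx; rewrite /halfspace /= !dotE dot0r oppr0 oppr_le0;
      exact: dot_cone_ge0.
  move=> Hy; apply: mem_self_dual => x /Hy.
  by rewrite /halfspace /= !dotE dot0r oppr0 oppr_le0.
by apply: closed_bigI => x _; exact: halfspace_closed.
Qed.

Lemma cone_convex : @convex_set R 'rV[R]_m K.
Proof.
apply/convex_setP => x y t Kx Ky /andP[t0 t1].
by apply: coneD; apply: coneZ; rewrite ?subr_ge0.
Qed.

(** Take for [p] the projection of [z] onto [K]. Testing at 0 and 2p gives orthogonality; the other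
    tests put [p - z] in the dual cone, which is [K]. *)
Lemma moreau_decomposition z :
  exists p n, [/\ K p, K n, dot p n = 0 & z = p - n].
Proof.
have [p np] := nearest_exists K z cone_closed (ex_intro _ 0 cone0).
have vp := nearest_variational K z p cone_convex np.
have Kp : K p by case: np.
have pn : dot (z - p) p = 0.
  have := vp 0 cone0; have := vp (p + p) (coneD _ _ Kp Kp).
  by rewrite addrK sub0r dotNr => h1 h2; lra.
exists p, (p - z); split=> //; last by rewrite opprB addrC subrK.
  apply: mem_self_dual => w Kw; have := vp w Kw.
  by rewrite dotDr dotNr pn -(opprB p z) dotNl dotC => h; lra.
by rewrite -(opprB z p) dotNr dotC pn oppr0.
Qed.

(** The residual of the projection is [n], which is orthogonal to [p] and nonnegative against
    [K]. *)
Lemma gmeetE x p n : K p -> K n -> dot p n = 0 ->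
  gmeet K x (x - (p - n)) = x - p.
Proof.
move=> Kp Kn pn; apply: metric_proj_eq; first by exists p.
move=> _ [k Kk <-].
have -> : x - (p - n) - (x - p) = n by apply/rowP => i; rewrite !mxE; ring.
have -> : x - k - (x - p) = p - k by apply/rowP => i; rewrite !mxE; ring.
rewrite dotDr dotNr dotC pn.
by have := dot_cone_ge0 _ _ Kn Kk; lra.
Qed.

Lemma gjoinE x p n : K p -> K n -> dot p n = 0 ->
  gjoin K x (x - (p - n)) = x + n.
Proof.
move=> Kp Kn pn; apply: metric_proj_eq; first by exists n.
move=> _ [k Kk <-].
have -> : x - (p - n) - (x + n) = - p by apply/rowP => i; rewrite !mxE; ring.
have -> : x + k - (x + n) = k - n by apply/rowP => i; rewrite !mxE; ring.
rewrite dotNl dotDr dotNr pn.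
by have := dot_cone_ge0 _ _ Kp Kk; lra.
Qed.

Lemma gmeet_gjoinE x y : exists p n,
  [/\ K p /\ K n, dot p n = 0, x - y = p - n,
      gmeet K x y = x - p & gjoin K x y = x + n].
Proof.
have [p [n [Kp Kn pn xy]]] := moreau_decomposition (x - y).
exists p, n; have -> : y = x - (p - n) by rewrite -xy opprB addrC subrK.
by rewrite gmeetE // gjoinE // opprB addrC subrK.
Qed.

Lemma gmeet_gjoin_sum x y : gmeet K x y + gjoin K x y = x + y.
Proof.
have [p [n [_ _ xy -> ->]]] := gmeet_gjoinE x y.
have -> : y = x - (p - n) by rewrite -xy opprB addrC subrK.
by apply/rowP => i; rewrite !mxE; ring.
Qed.

Lemma face_gl_invariant C F :
  gl_invariant K C -> face C F -> gl_invariant K F.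
Proof.
move=> iC [_ FC /convex_setP cF hF] x y Fx Fy.
have [Cm Cj] := iC x y (FC _ Fx) (FC _ Fy).
apply: (hF _ _ 2^-1 Cm Cj); first by apply/andP; split; lra.
have half : 1 - 2^-1 = 2^-1 :> R by lra.
rewrite half -scalerDr gmeet_gjoin_sum scalerDr -{2}half.
by apply: cF => //; apply/andP; split; lra.
Qed.

(** With [d] the positive part of [p - r], the tests at [p - d] and [r + d] give 0 <= <y - x, d> <=
    - <d, d>, hence [d] vanishes and [r - p] is [n]. *)
Lemma gl_invariant_isotone C : closed C -> C !=set0 ->
  @convex_set R 'rV[R]_m C -> gl_invariant K C -> isotone K (metric_proj C).
Proof.
move=> clC C0 cC iC x y Kxy; rewrite /cone_le.
have np := metric_proj_nearest C x clC C0.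
have nr := metric_proj_nearest C y clC C0.
move: (metric_proj C x) (metric_proj C y) np nr => p r np nr.
have [d [n [[Kd Kn] dn pr gm gj]]] := gmeet_gjoinE p r.
have [Cm Cj] : C (p - d) /\ C (r + d).
  have -> : r + d = p + n.
    have -> : p = r + (d - n) by rewrite -pr addrC subrK.
    by rewrite addrA subrK.
  by rewrite -gm -gj; apply: iC; [case: np|case: nr].
have h1 := nearest_variational C x p cC np _ Cm.
have h2 := nearest_variational C y r cC nr _ Cj.
have e1 : p - d - p = - d by rewrite addrAC subrr add0r.
have e2 : r + d - r = d by rewrite addrAC subrr add0r.
rewrite e1 dotNr in h1; rewrite e2 in h2.
have h3 := dot_cone_ge0 _ _ Kxy Kd.
have h4 : dot (y - x) d = dot (y - r) d - dot (x - p) d - dot (p - r) d.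
  by rewrite !dotE; ring.
have h5 : dot (p - r) d = dot d d.
  by rewrite pr dotDl dotNl (dotC n) dn subr0.
have d0 : d = 0.
  apply/eqP; rewrite -dot_eq0 eq_le dot_ge0 andbT.
  by move: h1 h2 h3 h4 h5 => *; lra.
by rewrite -opprB pr d0 sub0r opprK.
Qed.

(** The linear projection onto the orthogonal complement of [u]: the offset [a] of the hyperplane
    does not enter. *)
Definition cone_stable u :=
  forall w, K w -> K (w - (dot u w / dot u u) *: u).

Lemma cone_stable_hyperplane u a : u != 0 ->
  isotone_projection_set K (hyperplane u a) <-> cone_stable u.
Proof.
move=> u0; have diff x y : metric_proj (hyperplane u a) y -
    metric_proj (hyperplane u a) x =
    (y - x) - (dot u (y - x) / dot u u) *: u.
  rewrite !metric_proj_hyperplane // !dotE.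
  by apply/rowP => i; rewrite !mxE; ring.
split=> [[_ _ _ iso] w Kw|st].
  have := iso 0 w; rewrite /cone_le diff subr0; exact.
split; [by exists a|exact: hyperplane_closed|exact: hyperplane_convex|].
by move=> x y Kxy; rewrite /cone_le diff; exact: st.
Qed.

(** Pair [p] with the projection of [n] along [u], which stays in [K]. *)
Lemma cone_stable_opposite_sign u p n : u != 0 -> cone_stable u ->
  K p -> K n -> dot p n = 0 -> dot u p * dot u n <= 0.
Proof.
rewrite -dot_gt0 => u0 st Kp Kn pn.
have := dot_cone_ge0 _ _ Kp (st _ Kn).
rewrite dotDr pn dotNr dotZr (dotC p) add0r oppr_ge0 => h.
have : dot u u * (dot u n / dot u u * dot u p) <= 0.
  by rewrite pmulr_rle0.
by rewrite mulrA mulrCA mulfV ?gt_eqF // mulr1 mulrC.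
Qed.

(** Opposite signs of [dot u p] and [dot u n] keep the values of [dot u] at meet and join between
    those at [x] and [y]. *)
Lemma cone_stable_halfspace_invariant u a : u != 0 -> cone_stable u ->
  gl_invariant K (halfspace u a).
Proof.
move=> u0 st x y; rewrite /halfspace /= => ux uy.
have [p [n [[Kp Kn] pn xy -> ->]]] := gmeet_gjoinE x y.
have := cone_stable_opposite_sign _ _ _ u0 st Kp Kn pn.
have : dot u x - dot u y = dot u p - dot u n.
  by rewrite -dotNr -dotDr xy dotDr dotNr.
rewrite !dotE => h hs.
have [up|up] := leP 0 (dot u p).
  split; first by lra.
  (* If [dot u n] is positive, then [dot u p] is 0 and the join has the same level as [y]. *)
  by have [|un] := leP (dot u n) 0; [lra|nra].
by split; nra.
Qed.

Lemma cone_stable_hyperplane_invariant u a : u != 0 -> cone_stable u ->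
  gl_invariant K (hyperplane u a).
Proof.
move=> u0 st x y; rewrite /hyperplane /= => ux uy.
have [p [n [[Kp Kn] pn xy -> ->]]] := gmeet_gjoinE x y.
have := cone_stable_opposite_sign _ _ _ u0 st Kp Kn pn.
have : dot u x - dot u y = dot u p - dot u n.
  by rewrite -dotNr -dotDr xy dotDr dotNr.
rewrite !dotE ux uy subrr => /esym/subr0_eq <- up.
have /eqP : dot u p * dot u p = 0.
  by apply/eqP; rewrite eq_le up -expr2 sqr_ge0.
by rewrite mulf_eq0 orbb => /eqP ->; rewrite subr0 addr0.
Qed.

(* The hypothesis says that the hyperplane orthogonal to [u] is closed under
   the positive part; it is only ever checked on a germ of a hyperplane. *)
Lemma cone_stable_of_positive_part u : u != 0 ->
  (forall p n, K p -> K n -> dot p n = 0 -> dot u (p - n) = 0 ->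
     dot u p = 0) ->
  cone_stable u.
Proof.
rewrite -dot_gt0 => u0 hu w Kw.
have [p [n [Kp Kn pn wE]]] :=
  moreau_decomposition (w - (dot u w / dot u u) *: u).
have uz : dot u (p - n) = 0.
  by rewrite -wE dotDr dotNr dotZr divfK ?gt_eqF // subrr.
have up := hu p n Kp Kn pn uz.
have un : dot u n = 0 by move: uz; rewrite dotDr dotNr up; lra.
(* As [n] is orthogonal to [u] and [p], <w, n> = - <n, n>, while <w, n> >= 0 because both lie in
   [K]. *)
have n0 : n = 0.
  apply/eqP; rewrite -dot_eq0 eq_le dot_ge0 andbT.
  have : dot (w - (dot u w / dot u u) *: u) n = dot (p - n) n by rewrite wE.
  rewrite dotDl dotNl dotZl un mulr0 subr0 dotDl dotNl pn add0r => h.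
  by rewrite -oppr_ge0 -h; exact: dot_cone_ge0.
by rewrite wE n0 subr0.
Qed.

End SelfDualCone.

(** * Geometry of the polyhedron near its hyperfaces *)

Section Polyhedron.
Context {R : realType} {m : nat} (q : nat) (u a : 'I_q -> 'rV[R]_m).
Context (C : set 'rV[R]_m).
Hypothesis hC : C = \bigcap_(i in [set: 'I_q]) halfspace (u i) (a i).
Hypothesis hu : forall i, u i != 0.
Hypothesis hint : interior C !=set0.
Hypothesis hsharp : forall i, hyperface C (hyperplane (u i) (a i) `&` C).

Lemma mem_polyhedron x :
  C x <-> forall i, dot (u i) x <= dot (u i) (a i).
Proof. by rewrite hC; split=> [h i|h i _]; exact: h. Qed.

(** A short step along [u i] from an interior point stays in [C] and raises [dot (u i)], so
    constraint [i] was strict before the step. *)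
Lemma polyhedron_interior_point :
  exists x, forall i, dot (u i) x < dot (u i) (a i).
Proof.
have [x Cx] := hint; exists x => i.
have cg : {for 0, continuous (fun t : R => x + t *: u i)}.
  apply: (@continuousD R 'rV[R]_m _ (fun=> x) (fun t : R => t *: u i)).
    exact: cst_continuous.
  exact: (@scalel_continuous R 'rV[R]_m (u i)).
have /cvg_at_right_filter cr : (fun t : R => x + t *: u i) t @[t --> 0] --> x.
  have := cg; rewrite /prop_for /continuous_at (_ : x + 0 *: u i = x) //.
  by rewrite scale0r addr0.
have near_C : \forall t \near 0^'+, C (x + t *: u i) by move: (cr C Cx).
near (0 : R)^'+ => t.
have t0 : 0 < t by near: t; exact: nbhs_right_gt.
have Ct : C (x + t *: u i) by near: t.
have := (mem_polyhedron _).1 Ct i; rewrite !dotE; apply: lt_le_trans.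
by rewrite ltrDl mulr_gt0 // dot_gt0.
Unshelve. all: by end_near.
Qed.

Lemma hyperface_proper i : proper_face C (hyperplane (u i) (a i) `&` C).
Proof.
split; first by case: (hsharp i).
move=> eqC; have [x xlt] := polyhedron_interior_point.
have : C x by apply/mem_polyhedron => j; exact: ltW.
by rewrite -eqC => -[xH _]; have := xlt i; rewrite xH ltxx.
Qed.

Lemma affine_hull_hyperplane (v b : 'rV[R]_m) (S : set 'rV[R]_m) :
  S `<=` hyperplane v b -> affine_hull S `<=` hyperplane v b.
Proof.
move=> SH _ [n [c [s [Ss c1 ->]]]]; rewrite /hyperplane /=.
rewrite (big_morph (dot v) (dotDr v) (dot0r v)).
under eq_bigr => i _ do rewrite dotZr (SH _ (Ss i)).
by rewrite -mulr_suml c1 mul1r.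
Qed.

(* The direction space V of the hyperface and [u i] span everything, and the
   component of [u j] along V is orthogonal to itself. *)
Lemma hyperface_normal i j :
  hyperplane (u i) (a i) `&` C `<=` hyperplane (u j) (a j) ->
  exists l : R, u j = l *: u i.
Proof.
move=> sub; case: (hsharp i) => _ [d dm [b [V [hull dimV]]]].
have orth k : hyperplane (u i) (a i) `&` C `<=` hyperplane (u k) (a k) ->
    forall v, v \in V -> dot (u k) v = 0.
  move=> /affine_hull_hyperplane; rewrite hull => hk v vV.
  have /hk : [set b + v | v in [set` V]] (b + v) by exists v.
  have /hk : [set b + v | v in [set` V]] (b + 0) by exists 0 => //; exact: mem0v.
  by rewrite /hyperplane /= !dotE dot0r => h1 h2; lra.
have Vi := orth i (@subIsetl _ _ _).
have Vj := orth j sub.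
have ViI : (V :&: <[u i]>)%VS = 0%VS.
  apply/eqP; rewrite -subv0; apply/subvP => v; rewrite memv_cap => /andP[vV].
  by move=> /vlineP [t vE]; rewrite memv0 -dot_eq0 {1}vE dotZl (Vi v) // mulr0.
have : (V + <[u i]>)%VS = fullv.
  apply/eqP; rewrite eqEdim subvf dimvf dimv_disjoint_sum //.
  by rewrite dimV dim_vline hu /dim /= mul1n -dm addn1.
move=> full; have : u j \in (V + <[u i]>)%VS by rewrite full memvf.
move=> /memv_addP [v vV [_ /vlineP [l ->] ujE]].
exists l; suff v0 : v = 0 by rewrite ujE v0 add0r.
apply/eqP; rewrite -dot_eq0.
have -> : dot v v = dot (u j) v - l * dot (u i) v by rewrite ujE !dotE; ring.
by rewrite (Vi v) // (Vj v) // mulr0 subrr.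
Qed.

(** The normals are proportional and both hyperplanes contain [f]; a point strict for both
    constraints makes the factor positive. *)
Lemma hyperface_implied_constraint i j :
  hyperplane (u i) (a i) `&` C `<=` hyperplane (u j) (a j) ->
  halfspace (u i) (a i) `<=` halfspace (u j) (a j).
Proof.
move=> sub; have [l ujE] := hyperface_normal i j sub.
have [p plt] := polyhedron_interior_point.
have [[[f [fi Cf]] _ _ _] _] := hsharp i.
have fj := sub f (conj fi Cf).
have l0 : 0 < l.
  have := plt i; have := plt j.
  by rewrite -fj -fi ujE !dotZl => pj pi; nra.
move=> x; rewrite /halfspace /= -fj -fi ujE !dotZl => xi.
by rewrite ler_pM2l.
Qed.

(** Each constraint not implied by the [i]-th is strict somewhere on the hyperface. Successive
    midpoints collect these points, since strictness survives averaging with a point of [C]. *)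
Lemma hyperface_relative_interior i : exists2 c,
  (hyperplane (u i) (a i) `&` C) c &
  forall j, dot (u j) c < dot (u j) (a j) \/
    halfspace (u i) (a i) `<=` halfspace (u j) (a j).
Proof.
have [[[f Ff] _ /convex_setP cF _] _] := hsharp i.
suff [c Fc hc] : exists2 c, (hyperplane (u i) (a i) `&` C) c &
  forall j, j \in enum 'I_q -> dot (u j) c < dot (u j) (a j) \/
    halfspace (u i) (a i) `<=` halfspace (u j) (a j).
  by exists c => // j; apply: hc; rewrite mem_enum.
elim: (enum 'I_q) => [|j s [c Fc hc]]; first by exists f.
have half : 1 - 2^-1 = 2^-1 :> R by lra.
have half01 : 0 <= (2^-1 : R) <= 1 by apply/andP; split; lra.
have mid x y : (hyperplane (u i) (a i) `&` C) x ->
    (hyperplane (u i) (a i) `&` C) y ->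
    (hyperplane (u i) (a i) `&` C) (2^-1 *: x + 2^-1 *: y).
  by move=> Fx Fy; rewrite -{2}half; exact: cF.
have [sub|] :=
  pselect (hyperplane (u i) (a i) `&` C `<=` hyperplane (u j) (a j)).
  exists c => // k; rewrite inE => /orP[/eqP ->|/hc //].
  by right; exact: hyperface_implied_constraint.
move=> /existsNP [d /not_implyP [Fd dj]].
have le_at x k : (hyperplane (u i) (a i) `&` C) x ->
    dot (u k) x <= dot (u k) (a k).
  by move=> [_ /mem_polyhedron].
have dlt : dot (u j) d < dot (u j) (a j).
  by rewrite lt_neqAle le_at // andbT; apply/eqP.
exists (2^-1 *: c + 2^-1 *: d); first exact: mid.
move=> k; rewrite inE => /orP[/eqP ->|/hc [clt|]]; last by right.
  by left; have := le_at c j Fc; rewrite !dotE; lra.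
by left; have := le_at d k Fd; rewrite !dotE; lra.
Qed.

(* In a neighbourhood of a relative interior point of the hyperface, [C]
   coincides with the half-space of the constraint [i]. *)
Lemma polyhedron_locally_halfspace i : exists2 c,
  (hyperplane (u i) (a i) `&` C) c &
  forall z, dot (u i) z <= 0 -> exists2 t : R, 0 < t & C (c + t *: z).
Proof.
have [c Fc hc] := hyperface_relative_interior i.
exists c => // z uz; have [ci Cc] := Fc.
suff [t t0 ht] : exists2 t : R, 0 < t & forall j, j \in enum 'I_q ->
    halfspace (u j) (a j) (c + t *: z).
  by exists t => //; apply/mem_polyhedron => j; apply: ht; rewrite mem_enum.
elim: (enum 'I_q) => [|j s [t t0 ht]]; first by exists 1.
(* Since [c] satisfies every constraint, an admissible step length can be reduced; a common one is
   thus the minimum over the constraints. *)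
have shrink k r r' : 0 < r -> 0 < r' <= r ->
    halfspace (u k) (a k) (c + r *: z) -> halfspace (u k) (a k) (c + r' *: z).
  have := (mem_polyhedron c).1 Cc k; rewrite /halfspace /= !dotE => ck r0 /andP[r'0 r'r] h.
  by have [uk|uk] := leP (dot (u k) z) 0; nra.
have [r r0 hr] : exists2 r, 0 < r & halfspace (u j) (a j) (c + r *: z).
  case: (hc j) => [cj|sub]; last first.
    exists 1 => //; apply: sub; rewrite /halfspace /= scale1r dotDr ci.
    by rewrite gerDl.
  have [uj|uj] := leP (dot (u j) z) 0.
    by exists 1 => //; rewrite /halfspace /= scale1r dotDr; lra.
  (* The step at which the ray from [c] meets the hyperplane of constraint [j]. *)
  exists ((dot (u j) (a j) - dot (u j) c) / dot (u j) z).
    by rewrite divr_gt0 // subr_gt0.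
  by rewrite /halfspace /= !dotE divfK ?gt_eqF // addrC subrK.
have min0 : 0 < Num.min r t by rewrite lt_min r0 t0.
exists (Num.min r t) => // k; rewrite inE => /orP[/eqP ->|ks].
  by apply: shrink hr; rewrite // min0 ge_min lexx.
by apply: shrink (ht k ks); rewrite // min0 ge_min lexx orbT.
Qed.

End Polyhedron.

(** * Stability of [K] recovered from the polyhedron and its faces *)

Section IsotonePolyhedron.
Context {R : realType} {m : nat} (K : set 'rV[R]_m).
Hypothesis hK : self_dual_cone K.
Implicit Types (u a : 'rV[R]_m) (C : set 'rV[R]_m).

Lemma bigcap_gl_invariant (J : Type) (A : J -> set 'rV[R]_m) :
  (forall i, gl_invariant K (A i)) -> gl_invariant K (\bigcap_i A i).
Proof.
by move=> iA x y Ax Ay; split=> i _; have [] := iA i x y (Ax i I) (Ay i I).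
Qed.

(* Near [c] the projection onto [C] is the projection onto the half-space, so
   comparing it at [c] with its values at [c + t w] or [c - t w], whichever
   lies outside the half-space, gives the stability of [K]. *)
Lemma isotone_cone_stable u a C c : u != 0 ->
  C `<=` halfspace u a -> hyperplane u a c -> C c ->
  (forall z, dot u z <= 0 -> exists2 t : R, 0 < t & C (c + t *: z)) ->
  isotone K (metric_proj C) -> cone_stable K u.
Proof.
rewrite -dot_gt0 => u0 Ch ch Cc loc iso w Kw.
set s := dot u w / dot u u.
have uz : dot u (w - s *: u) = 0.
  by rewrite dotDr dotNr dotZr divfK ?gt_eqF // subrr.
(* The displacement from [c + t z] is a nonnegative multiple of [u], and [c + t z] lies on the
   supporting hyperplane, so the variational inequality holds. *)
have proj t z r : 0 < t -> 0 <= r -> dot u z = 0 -> C (c + t *: z) ->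
    metric_proj C (c + t *: (z + r *: u)) = c + t *: z.
  move=> t0 r0 z0 Cz; apply: metric_proj_eq => // y /Ch.
  have -> : c + t *: (z + r *: u) - (c + t *: z) = (t * r) *: u.
    by apply/rowP => i; rewrite !mxE; ring.
  rewrite /halfspace /= -ch dotZl !dotE z0 => uy.
  by apply: mulr_ge0_le0; [exact: mulr_ge0 (ltW t0) r0|lra].
have [s0|s0] := leP 0 s.
  have [|t t0 Ct] := loc (w - s *: u); first by rewrite uz.
  have := iso c (c + t *: w); rewrite /cone_le (metric_proj_id C c) //.
  rewrite -{2}(subrK (s *: u) w) proj // !(addrC c) !addrK => K_t.
  by apply: (coneZ_pos K hK t _ t0); apply: K_t; apply: coneZ => //; exact: ltW.
have nuz : dot u (- (w - s *: u)) = 0 by rewrite dotNr uz oppr0.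
have [|t t0 Ct] := loc (- (w - s *: u)); first by rewrite nuz.
have := iso (c - t *: w) c; rewrite /cone_le (metric_proj_id C c) //.
have -> : c - t *: w = c + t *: (- (w - s *: u) + (- s) *: u).
  by apply/rowP => i; rewrite !mxE; ring.
rewrite proj //; last by rewrite oppr_ge0 ltW.
have sub z : c - (c + t *: z) = t *: (- z).
  by rewrite opprD addrA subrr sub0r scalerN.
rewrite !sub opprK opprD !opprK scaleNr opprK subrK => K_t.
by apply: (coneZ_pos K hK t _ t0); apply: K_t; apply: coneZ => //; exact: ltW.
Qed.

(** The meet of [c] and c - t (p - n) is c - t p; its membership in the hyperplane forces <u, p> =
    0. *)
Lemma face_invariant_cone_stable u a C c : u != 0 ->
  hyperplane u a c -> C c ->
  (forall z, dot u z <= 0 -> exists2 t : R, 0 < t & C (c + t *: z)) ->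
  gl_invariant K (hyperplane u a `&` C) -> cone_stable K u.
Proof.
move=> u0 ch Cc loc inv.
apply: cone_stable_of_positive_part => // p n Kp Kn pn uz.
have nuz : dot u (- (p - n)) = 0 by rewrite dotNr uz oppr0.
have [|t t0 Ct] := loc (- (p - n)); first by rewrite nuz.
have Hy : hyperplane u a (c + t *: - (p - n)).
  by rewrite /hyperplane /= dotDr dotZr nuz mulr0 addr0.
have [[+ _] _] := inv _ _ (conj ch Cc) (conj Hy Ct).
have -> : c + t *: - (p - n) = c - (t *: p - t *: n).
  by rewrite scalerN scalerBr.
rewrite (gmeetE K hK) //; first last.
- by rewrite dotZl dotZr pn !mulr0.
- by apply: coneZ => //; exact: ltW.
- by apply: coneZ => //; exact: ltW.
rewrite /hyperplane /= -ch !dotE => h.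
have /eqP : t * dot u p = 0 by lra.
by rewrite mulf_eq0 gt_eqF // => /eqP.
Qed.

End IsotonePolyhedron.

Theorem theorem3 (R : realType) (m : nat) (K : set 'rV[R]_m)
    (hK : self_dual_cone K)
    (q : nat) (u a : 'I_q -> 'rV[R]_m) (C : set 'rV[R]_m)
    (hu : forall i, u i != 0)
    (hC : C = \bigcap_(i in [set: 'I_q]) halfspace (u i) (a i))
    (hint : interior C !=set0)
    (hsharp : forall i, hyperface C (hyperplane (u i) (a i) `&` C)) :
  [<-> gl_invariant K C;
       isotone K (metric_proj C);
       forall i, gl_invariant K (hyperplane (u i) (a i));
       forall i, isotone_projection_set K (hyperplane (u i) (a i));
       forall F : set 'rV[R]_m, proper_face C F -> gl_invariant K F].
Proof.
have local (i : 'I_q) := polyhedron_locally_halfspace q u a C hC hu hint hsharp i.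
have invC : (forall i, cone_stable K (u i)) -> gl_invariant K C.
  move=> st; rewrite hC; apply: bigcap_gl_invariant => i.
  exact: cone_stable_halfspace_invariant.
tfae.
- apply: gl_invariant_isotone => //; rewrite ?hC.
  + by apply: closed_bigI => i _; exact: halfspace_closed.
  + by rewrite -hC; have [x /interior_subset Cx] := hint; exists x.
  + by apply: bigcap_convex => i; exact: halfspace_convex.
- move=> iso i; apply: cone_stable_hyperplane_invariant => //.
  have [c [ci Cc] hc] := local i.
  apply: (isotone_cone_stable K hK (u i) (a i) C c) => // x.
  by rewrite hC; apply.
- move=> inv i; apply/cone_stable_hyperplane => //.
  (* With the whole space in place of [C], the face is the full hyperplane and every direction is
     admissible at [a i]. *)
  apply: (face_invariant_cone_stable K hK (u i) (a i) setT (a i)) => //.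
    by move=> z _; exists 1.
  by rewrite setIT.
- move=> iso F [fF _]; apply: face_gl_invariant fF => //; apply: invC => i.
  by apply/(cone_stable_hyperplane K (u i) (a i)).
- move=> inv; apply: invC => i; have [c [ci Cc] hc] := local i.
  apply: (face_invariant_cone_stable K hK (u i) (a i) C c) => //.
  exact: inv (hyperface_proper q u a C hC hu hint hsharp i).
Qed.
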